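(* Let $n\ge 2$ be an integer, and let $S$ be a spherical two-distance set in $\mathbf{R}^n$ with inner products $a$ and $b$. Suppose $(a,b)\in D_i^{(n)}$ for some $i\in\{1,2,3,4,5\}$. Then $$|S|\le U_i^{(n)}(a,b).$$
   Context: A spherical two-distance set in $\mathbf{R}^n$ with inner products $a$ and $b$ is a set $S$ of unit vectors in $\mathbf{R}^n$, together with real numbers $a,b\in\mathbf{I}:=[-1,1)$, such that the inner product of any two distinct vectors of $S$ is either $a$ or $b$. Gegenbauer polynomials $G_k^{(n)}(t)$, normalized by $G_k^{(n)}(1)=1$, are given by $G_0^{(n)}=1$, $G_1^{(n)}=t$, and for $k\ge 2$ $$G_k^{(n)}=\frac{(2k+n-4)\,t\,G_{k-1}^{(n)}-(k-1)\,G_{k-2}^{(n)}}{k+n-3}.$$ For given $n,a,b$, define polynomials $P_i(t)$, $i=1,\dots,5$, with Gegenbauer expansions $P_i(t)=\sum_k f_k^{(i)}G_k^{(n)}(t)$ (the sum running over $0\le k\le \deg P_i$), as follows: - $P_1(t)=(t-a)(t-b)$. - $P_2(t)=(t-a)(t-b)(t+c)$, where $c$ is determined by the equation $f_1^{(2)}=0$; it is well defined when $a+b\ne 0$, and then $c=\frac{ab(n+2)+3}{(n+2)(a+b)}$. - $P_3(t)=(t-a)(t-b)(t+a+b)$. - $P_4(t)=(t-a)(t-b)(t^2+c\,t+d)$, where $c,d$ are determined by the equations $f_1^{(4)}=f_2^{(4)}=0$. - $P_5(t)=(t-a)(t-b)(t^2+c\,t+d)$, where $c,d$ are determined by the equations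 $f_2^{(5)}=f_3^{(5)}=0$. Here $P_i$ is called well defined if the stated equations determine its parameters ($c$, or $c$ and $d$) uniquely; $P_1$ and $P_3$ are always well defined. $D_i^{(n)}$ denotes the set of all pairs $(a,b)\in\mathbf{I}^2$ such that $P_i$ is well defined, all coefficients $f_k^{(i)}\ge 0$, and $f_0^{(i)}>0$. For $(a,b)\in D_i^{(n)}$, $$U_i^{(n)}(a,b):=\frac{P_i(1)}{f_0^{(i)}}.$$ *)

(* Defs.v *)
From mathcomp Require Import all_boot all_order all_algebra finmap.
From mathcomp Require Import boolp classical_sets cardinality reals.
From mathcomp Require Import ring lra.

Set Implicit Arguments.
Unset Strict Implicit.
Unset Printing Implicit Defensive.

Import Order.TTheory GRing.Theory Num.Theory.

Local Open Scope classical_set_scope.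
Local Open Scope ring_scope.

Section TwoDistance.
Variables (R : realType) (n : nat).

(* The norm `|x| that MathComp-Analysis puts on 'rV[R]_n is the sup norm, so
   unit vectors are expressed through this inner product instead. *)
Definition dotp (x y : 'rV[R]_n) : R := \sum_(i < n) x 0 i * y 0 i.

(* Neither a != b nor the occurrence of both values in S is required. *)
Definition spherical_two_distance_set (S : set 'rV[R]_n) (a b : R) : Prop :=
  [/\ a \in `[-1, 1[, b \in `[-1, 1[,
      forall x, S x -> dotp x x = 1
    & forall x y, S x -> S y -> x <> y -> dotp x y = a \/ dotp x y = b].

End TwoDistance.

Section Gegenbauer.
Variables (R : realType) (n : nat).

Fixpoint gegenbauer (k : nat) : {poly R} :=
  match k with
  | 0 => 1
  | 1 => 'X
  | (k''.+1 as k').+1 =>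
      (k%:R + n%:R - 3)^-1 *:
        ((2 * k%:R + n%:R - 4) *: ('X * gegenbauer k')
         - (k%:R - 1) *: gegenbauer k'')
  end.

(* A finite sequence of Gegenbauer coefficients f_0, f_1, ... is encoded as the
   polynomial f whose coefficient in degree k is f_k. *)
Definition gegenbauer_sum (f : {poly R}) : {poly R} :=
  \sum_(k < size f) f`_k *: gegenbauer k.

Definition gegenbauer_coefs (p : {poly R}) : {poly R} :=
  xget 0 [set f | p = gegenbauer_sum f].

Definition gegenbauer_coef (p : {poly R}) (k : nat) : R :=
  (gegenbauer_coefs p)`_k.

Lemma gegenbauerSS k : gegenbauer k.+2 =
  (k.+2%:R + n%:R - 3)^-1 *:
     ((2 * k.+2%:R + n%:R - 4) *: ('X * gegenbauer k.+1)
       - (k.+2%:R - 1) *: gegenbauer k).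
Proof. by []. Qed.

Lemma size_gegenbauer k : (2 <= n)%N -> size (gegenbauer k) = k.+1.
Proof.
move=> n2.
suff: size (gegenbauer k) = k.+1 /\ size (gegenbauer k.+1) = k.+2 by case.
elim: k => [|k [IH0 IH1]]; first by rewrite /= size_poly1 size_polyX.
split=> //; rewrite gegenbauerSS.
have n2R : 2 <= n%:R :> R by rewrite ler_nat.
have k0 : 0 <= k%:R :> R by rewrite ler0n.
have kE : k.+2%:R = k%:R + 2 :> R by rewrite -addn2 natrD.
have s1 : size ((2 * k.+2%:R + n%:R - 4) *: ('X * gegenbauer k.+1)) = k.+3.
  rewrite size_scale; first by rewrite mulrC size_mulX -?size_poly_eq0 IH1.
  by apply: lt0r_neq0; rewrite kE; lra.
rewrite size_scale; last by rewrite invr_eq0; apply: lt0r_neq0; rewrite kE; lra.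
rewrite size_polyDl s1 // size_polyN.
by apply: leq_ltn_trans (size_scale_leq _ _) _; rewrite IH0.
Qed.

Lemma gegenbauer_sumE (f : {poly R}) m : (size f <= m)%N ->
  gegenbauer_sum f = \sum_(k < m) f`_k *: gegenbauer k.
Proof.
move=> fm; rewrite /gegenbauer_sum (big_ord_widen _ (fun k => f`_k *: gegenbauer k) fm).
rewrite big_mkcond; apply: eq_bigr => k _.
by case: ltnP => // /(nth_default 0) ->; rewrite scale0r.
Qed.

Lemma gegenbauer_sumB (f g : {poly R}) :
  gegenbauer_sum (f - g) = gegenbauer_sum f - gegenbauer_sum g.
Proof.
set m := maxn (size f) (size g).
rewrite !(@gegenbauer_sumE _ m) ?leq_maxl ?leq_maxr //; last first.
  by rewrite (leq_trans (size_polyD _ _)) // size_polyN.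
by rewrite -sumrB; apply: eq_bigr => k _; rewrite coefB scalerBl.
Qed.

Lemma size_gegenbauer_sum f : (2 <= n)%N -> size (gegenbauer_sum f) = size f.
Proof.
move=> n2; rewrite /gegenbauer_sum; case sf: (size f) => [|m].
  by rewrite big_ord0 size_poly0.
have fm : f`_m != 0.
  by have := lead_coef_eq0 f; rewrite lead_coefE sf /= => ->; rewrite -size_poly_eq0 sf.
rewrite big_ord_recr /= addrC size_polyDl size_scale ?size_gegenbauer //.
rewrite ltnS; apply: (leq_trans (size_sum _ _ _)); apply/bigmax_leqP => k _.
by rewrite (leq_trans (size_scale_leq _ _)) // size_gegenbauer.
Qed.

Lemma gegenbauer_sum_inj : (2 <= n)%N -> injective gegenbauer_sum.
Proof.
move=> n2 f g /eqP; rewrite -subr_eq0 -gegenbauer_sumB -size_poly_eq0.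
by rewrite size_gegenbauer_sum // size_poly_eq0 subr_eq0 => /eqP.
Qed.

Lemma gegenbauer_sum_surj p : (2 <= n)%N -> exists f, p = gegenbauer_sum f.
Proof.
move=> n2; have [m] := ubnP (size p); elim: m p => // m IH p; rewrite ltnS => pm.
have [->|p0] := eqVneq p 0.
  by exists 0; rewrite /gegenbauer_sum size_poly0 big_ord0.
have sp : size p = (size p).-1.+1 by rewrite prednK // lt0n size_poly_eq0.
set d := (size p).-1 in sp; set g := gegenbauer d.
have sg : size g = d.+1 by rewrite size_gegenbauer.
have lg : lead_coef g != 0 by rewrite lead_coef_eq0 -size_poly_eq0 sg.
set c := lead_coef p / lead_coef g.
have [|f fE] := IH (p - c *: g).
  apply: (@leq_trans d.+1); last by rewrite -sp.
  rewrite ltnS; apply/leq_sizeP => j; rewrite leq_eqVlt => /predU1P[<-|dj].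
    rewrite coefB coefZ /c !lead_coefE sp sg /=.
    by rewrite divfK ?subrr //; rewrite lead_coefE sg in lg.
  by rewrite coefB coefZ !nth_default ?sg ?sp // mulr0 subr0.
exists (f - (- c) *: 'X^d); rewrite gegenbauer_sumB -fE.
rewrite (@gegenbauer_sumE (- c *: 'X^d) d.+1); last first.
  by rewrite (leq_trans (size_scale_leq _ _)) // size_polyXn.
rewrite big_ord_recr big1 /= => [|k _].
  by rewrite coefZ coefXn eqxx mulr1 add0r scaleNr opprK subrK.
by rewrite coefZ coefXn (ltn_eqF (ltn_ord k)) mulr0 scale0r.
Qed.

Lemma gegenbauer_coefsP p f : (2 <= n)%N ->
  p = gegenbauer_sum f <-> gegenbauer_coefs p = f.
Proof.
move=> n2; have := gegenbauer_sum_surj p n2 => /(xgetPex 0) /= h; split=> [pf|<-//].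
by apply: gegenbauer_sum_inj => //; rewrite -pf -h.
Qed.

End Gegenbauer.

Section Bounds.
Variables (R : realType) (n : nat).
Implicit Types (i : nat) (a b c d : R) (ab cd : R * R).

Definition quad a b : {poly R} := ('X - a%:P) * ('X - b%:P).
Definition cubic a b c : {poly R} := quad a b * ('X + c%:P).
Definition quartic a b cd : {poly R} :=
  quad a b * ('X^2 + cd.1 *: 'X + cd.2%:P).

Definition params2 a b : set R :=
  [set c | gegenbauer_coef n (cubic a b c) 1 = 0].

Definition params4 a b : set (R * R) :=
  [set cd | gegenbauer_coef n (quartic a b cd) 1 = 0 /\
            gegenbauer_coef n (quartic a b cd) 2 = 0].

Definition params5 a b : set (R * R) :=
  [set cd | gegenbauer_coef n (quartic a b cd) 2 = 0 /\
            gegenbauer_coef n (quartic a b cd) 3 = 0].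

(* The index i ranges over 1, ..., 5; other values are never well defined. *)
Definition well_defined i a b : Prop :=
  match i with
  | 1 | 3 => True
  | 2 => exists! c, params2 a b c
  | 4 => exists! cd, params4 a b cd
  | 5 => exists! cd, params5 a b cd
  | _ => False
  end.

(* Meaningful only when well_defined i a b holds. *)
Definition P i a b : {poly R} :=
  match i with
  | 1 => quad a b
  | 2 => cubic a b (xget 0 (params2 a b))
  | 3 => cubic a b (a + b)
  | 4 => quartic a b (xget (0, 0) (params4 a b))
  | 5 => quartic a b (xget (0, 0) (params5 a b))
  | _ => 0
  end.

Definition D i : set (R * R) :=
  [set ab | let: (a, b) := ab in
    [/\ a \in `[-1, 1[, b \in `[-1, 1[, well_defined i a b,
        forall k, (k < size (P i a b))%N ->
          0 <= gegenbauer_coef n (P i a b) k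
      & 0 < gegenbauer_coef n (P i a b) 0]].

Definition U i a b : R := (P i a b).[1] / gegenbauer_coef n (P i a b) 0.

End Bounds.

(* Main.v *)
(** The Delsarte linear programming bound.  Each [P_i] has degree at most 4, so
    only the positive definiteness of [G_0, ..., G_4] on the sphere is needed:
    up to a positive factor, [G_k(<x, y>)] is the inner product of the trace-free
    parts of the symmetric tensors [x^{(x)k}] and [y^{(x)k}].  Since [P_i]
    vanishes at [a] and [b], summing [P_i(<x, y>)] over all pairs from [N] points
    of [S] gives [N P_i(1)], while the Gegenbauer expansion bounds it below by
    [N^2 f_0]. *)
Require Import Defs.
From mathcomp Require Import all_boot all_order all_algebra finmap.
From mathcomp Require Import boolp classical_sets cardinality reals.
From mathcomp Require Import ring lra.

Set Implicit Arguments.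
Unset Strict Implicit.
Unset Printing Implicit Defensive.

Import Order.TTheory GRing.Theory Num.Theory.

Local Open Scope classical_set_scope.
Local Open Scope ring_scope.

(** * Trace-free symmetric tensors of degree 2, 3 and 4, and their inner products *)

Section HarmonicTensors.
Variables (R : realFieldType) (I : finType).
Implicit Types (u v : I -> R) (i j k l : I).

Local Notation n := (#|I|%:R : R).
Local Notation "''d_' ( i , j )" := ((i == j)%:R : R) (format "''d_' ( i ,  j )").

Definition inner u v : R := \sum_i u i * v i.

Lemma deltaC i j : 'd_(i, j) = 'd_(j, i).
Proof. by rewrite eq_sym. Qed.

Lemma sum_delta i (F : I -> R) : \sum_k 'd_(i, k) * F k = F i.
Proof.
rewrite (bigD1 i) //= eqxx mul1r big1 ?addr0 // => k ki.
by rewrite eq_sym (negbTE ki) mul0r.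
Qed.

(** Contracting one index of a harmonic tensor of [v] with [u]: as a function of the contracted
    index, every term is a multiple of [v k], of [u k] or of a delta. Shapes that do not occur get
    coefficient 0. *)
Lemma contract u v (A B C D E : R) i j l :
  \sum_k u k * (A * v k + B * u k + C * 'd_(i, k) + D * 'd_(j, k) + E * 'd_(l, k))
  = A * inner u v + B * inner u u + C * u i + D * u j + E * u l.
Proof.
rewrite -[in RHS](sum_delta i u) -[in RHS](sum_delta j u) -[in RHS](sum_delta l u).
rewrite /inner !mulr_sumr -!big_split /=.
by apply: eq_bigr => k _; ring.
Qed.

Lemma inner_comb u v (A B : R) :
  \sum_i u i * (A * v i + B * u i) = A * inner u v + B * inner u u.
Proof.
by rewrite /inner !mulr_sumr -big_split /=; apply: eq_bigr => i _; ring.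
Qed.

(** The summands are the shapes that appear when the last two indices of [harm3] or [harm4] are set
    equal and summed. *)
Lemma contract_diag v (A B C D E F : R) i j :
  \sum_k (A * (v k * v k) + B * ('d_(i, k) * v k) + C * ('d_(j, k) * v k)
          + D * ('d_(i, k) * 'd_(j, k)) + E * 'd_(k, k) + F)
  = A * inner v v + B * v i + C * v j + D * 'd_(i, j) + E * n + F * n.
Proof.
rewrite !big_split /= -!mulr_sumr !sum_delta (deltaC i j).
under [\sum_k 'd_(k, k)]eq_bigr do rewrite eqxx.
by rewrite !sumr_const -[F *+ _]mulr_natr.
Qed.

(** [harm2], [harm3] and [harm4] are normalized for unit vectors: the powers of [inner u u] that
    multiply the delta terms in general are replaced by 1. *)
Definition harm2 u i j : R := u i * u j - n^-1 * 'd_(i, j).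

Definition harm3 u i j k : R :=
  u i * u j * u k
  - (n + 2)^-1 * ('d_(i, j) * u k + 'd_(i, k) * u j + 'd_(j, k) * u i).

Definition harm4 u i j k l : R :=
  u i * u j * u k * u l
  - (n + 4)^-1 * ('d_(i, j) * u k * u l + 'd_(i, k) * u j * u l
                 + 'd_(i, l) * u j * u k + 'd_(j, k) * u i * u l
                 + 'd_(j, l) * u i * u k + 'd_(k, l) * u i * u j)
  + ((n + 2) * (n + 4))^-1 *
      ('d_(i, j) * 'd_(k, l) + 'd_(i, k) * 'd_(j, l) + 'd_(i, l) * 'd_(j, k)).

Lemma harm2_trace u : (0 < #|I|)%N -> inner u u = 1 -> \sum_i harm2 u i i = 0.
Proof.
move=> n0 uu; rewrite sumrB -mulr_sumr -/(inner u u) uu.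
under eq_bigr do rewrite eqxx.
by rewrite sumr_const mulVf ?subrr // pnatr_eq0 -lt0n.
Qed.

Lemma harm3_trace u i : inner u u = 1 -> \sum_k harm3 u i k k = 0.
Proof.
move=> uu; set c : R := (n + 2)^-1.
have cE : c * (n + 2) = 1.
  by rewrite mulVf // gt_eqF // ltr_wpDl ?ler0n ?ltr0n.
transitivity (u i * inner u u + (- c * 2) * u i + 0 * u i + 0 * 'd_(i, i)
    + (- c * u i) * n + 0 * n).
  rewrite -contract_diag; apply: eq_bigr => k _.
  by rewrite /harm3 -/c; ring.
transitivity (u i * (1 - c * (n + 2))); last by rewrite cE subrr mulr0.
by rewrite uu; ring.
Qed.

(** With [c] and [e] the two coefficients of [harm4], the trace is [(1 - c * (n + 4)) * u i * u j +
    (e * (n + 2) - c) * 'd_(i, j)], and both brackets vanish. *)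
Lemma harm4_trace u i j : inner u u = 1 -> \sum_k harm4 u i j k k = 0.
Proof.
move=> uu; have n0 : 0 <= n by exact: ler0n.
have n2 : n + 2 != 0 by rewrite gt_eqF // ltr_wpDl ?ltr0n.
have n4 : n + 4 != 0 by rewrite gt_eqF // ltr_wpDl ?ltr0n.
pose c : R := (n + 4)^-1; pose e : R := ((n + 2) * (n + 4))^-1.
transitivity ((u i * u j - c * 'd_(i, j)) * inner u u + (- c * 2 * u j) * u i
    + (- c * 2 * u i) * u j + (2 * e) * 'd_(i, j)
    + (e * 'd_(i, j) - c * u i * u j) * n + 0 * n).
  rewrite -contract_diag; apply: eq_bigr => k _.
  have dkk : 'd_(k, k) = 1 by rewrite eqxx.
  by rewrite /harm4 -/c -/e dkk; ring.
by rewrite uu /c /e; field; rewrite n2 n4.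
Qed.

(** The delta term of [harm2 u] only sees the trace of [harm2 v], which is zero, so it suffices to
    contract [harm2 v] twice with [u]. *)
Lemma inner_harm2 u v : (0 < #|I|)%N -> inner u u = 1 -> inner v v = 1 ->
  \sum_i \sum_j harm2 u i j * harm2 v i j = inner u v ^+ 2 - n^-1.
Proof.
move=> n0 uu vv.
transitivity (\sum_i (u i * (inner u v * v i - n^-1 * u i)
                      + (- n^-1) * harm2 v i i)).
  apply: eq_bigr => i _.
  rewrite -(sum_delta i (fun j => harm2 v i j)) mulr_sumr.
  have -> : inner u v * v i - n^-1 * u i = v i * inner u v + 0 * inner u u
     + (- n^-1) * u i + 0 * u i + 0 * u i by ring.
  rewrite -contract mulr_sumr -big_split /=; apply: eq_bigr => j _.
  by rewrite /harm2; ring.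
rewrite big_split /= -mulr_sumr harm2_trace // mulr0 addr0.
transitivity (\sum_i u i * (inner u v * v i + (- n^-1) * u i)).
  by apply: eq_bigr => i _; rewrite mulNr.
by rewrite inner_comb uu; ring.
Qed.

(** The three delta terms of [harm3 u] pair to zero with the trace-free [harm3 v]. What remains is
    [harm3 v] contracted three times with [u], computed one index at a time from the innermost sum
    outwards. *)
Lemma inner_harm3 u v : inner u u = 1 -> inner v v = 1 ->
  \sum_i \sum_j \sum_k harm3 u i j k * harm3 v i j k
  = inner u v ^+ 3 - 3 * (n + 2)^-1 * inner u v.
Proof.
move=> uu vv; set c : R := (n + 2)^-1; set t := inner u v.
have tr1 : \sum_i \sum_j \sum_k 'd_(j, k) * (u i * harm3 v i j k) = 0.
  rewrite big1 // => i _; under eq_bigr do rewrite sum_delta.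
  by rewrite -mulr_sumr harm3_trace // mulr0.
have tr2 : \sum_i \sum_j \sum_k 'd_(i, k) * (u j * harm3 v i j k) = 0.
  rewrite exchange_big /= big1 // => j _.
  under eq_bigr do rewrite sum_delta.
  rewrite -mulr_sumr (eq_bigr (fun i => harm3 v j i i)) ?harm3_trace ?mulr0 //.
  by move=> i _; rewrite /harm3 (deltaC j i); ring.
have tr3 : \sum_i \sum_j \sum_k 'd_(i, j) * (u k * harm3 v i j k) = 0.
  under eq_bigr do rewrite exchange_big /=.
  rewrite exchange_big /= big1 // => k _.
  under eq_bigr do rewrite sum_delta.
  rewrite -mulr_sumr (eq_bigr (fun i => harm3 v k i i)) ?harm3_trace ?mulr0 //.
  by move=> i _; rewrite /harm3 (deltaC k i); ring.
transitivity (\sum_i u i * \sum_j u j * \sum_k u k * harm3 v i j k).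
  transitivity (\sum_i u i * (\sum_j u j * \sum_k u k * harm3 v i j k)
    + (- c) * (\sum_i \sum_j \sum_k 'd_(i, j) * (u k * harm3 v i j k)
             + \sum_i \sum_j \sum_k 'd_(i, k) * (u j * harm3 v i j k)
             + \sum_i \sum_j \sum_k 'd_(j, k) * (u i * harm3 v i j k))).
    rewrite -!big_split mulr_sumr -big_split /=; apply: eq_bigr => i _.
    rewrite -!big_split !mulr_sumr -big_split /=; apply: eq_bigr => j _.
    rewrite -!big_split !mulr_sumr -big_split /=; apply: eq_bigr => k _.
    by rewrite [harm3 u _ _ _]/harm3 -/c; ring.
  by rewrite tr1 tr2 tr3; ring.
have c3 i j : \sum_k u k * harm3 v i j k
    = t * (v i * v j - c * 'd_(i, j)) - c * (v j * u i + v i * u j).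
  transitivity ((v i * v j - c * 'd_(i, j)) * t + 0 * inner u u
    + (- c * v j) * u i + (- c * v i) * u j + 0 * u i); last by ring.
  by rewrite -contract; apply: eq_bigr => k _; rewrite /harm3 -/c; ring.
have c2 i : \sum_j u j * (\sum_k u k * harm3 v i j k)
    = (t ^+ 2 - c) * v i - 2 * c * t * u i.
  transitivity ((t * v i - c * u i) * t + (- c * v i) * inner u u
    + (- c * t) * u i + 0 * u i + 0 * u i); last by rewrite uu; ring.
  by rewrite -contract; apply: eq_bigr => j _; rewrite c3; ring.
under eq_bigr do rewrite c2.
transitivity (\sum_i u i * ((t ^+ 2 - c) * v i + (- 2 * c * t) * u i)).
  by apply: eq_bigr => i _; ring.
by rewrite inner_comb uu -/t; ring.
Qed.

(** A delta collapses two indices of [B] and leaves one of its traces; by the symmetry of [B] all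
    these traces reduce to the one over the last two indices. *)
Lemma traceless_orthogonal (B : I -> I -> I -> I -> R) (f : I -> I -> R) :
    (forall i j k l, B i j k l = B j i k l) ->
    (forall i j k l, B i j k l = B i k j l) ->
    (forall i j k l, B i j k l = B i j l k) ->
    (forall i j, \sum_k B i j k k = 0) ->
  \sum_i \sum_j \sum_k \sum_l
    ('d_(i, j) * f k l + 'd_(i, k) * f j l + 'd_(i, l) * f j k
     + 'd_(j, k) * f i l + 'd_(j, l) * f i k + 'd_(k, l) * f i j) * B i j k l
  = 0.
Proof.
move=> B12 B23 B34 trB.
pose Q F : R := \sum_(i : I) \sum_(j : I) \sum_(k : I) \sum_(l : I) F i j k l.
have eqQ F G : (forall i j k l, F i j k l = G i j k l) -> Q F = Q G.
  by move=> FG; do 4![apply: eq_bigr => ? _].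
have Q12 F : Q F = Q (fun i j => F j i) by rewrite /Q exchange_big.
have Q23 F : Q F = Q (fun i j k => F i k j).
  by apply: eq_bigr => i _; rewrite exchange_big.
have Q34 F : Q F = Q (fun i j k l => F i j l k).
  by do 2![apply: eq_bigr => ? _]; rewrite exchange_big.
(* The only term computed directly. Each of the other five follows from an earlier one by
   transposing two adjacent indices, which moves the delta and preserves [B]. *)
have tkl : Q (fun i j k l => 'd_(k, l) * f i j * B i j k l) = 0.
  rewrite /Q big1 // => i _; rewrite big1 // => j _.
  transitivity (\sum_k \sum_l 'd_(k, l) * (f i j * B i j k l)).
    by do 2![apply: eq_bigr => ? _]; rewrite mulrA.
  by under eq_bigr do rewrite sum_delta; rewrite -mulr_sumr trB mulr0.
have tjl : Q (fun i j k l => 'd_(j, l) * f i k * B i j k l) = 0.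
  by rewrite Q23 -[RHS]tkl; apply: eqQ => i j k l; rewrite -B23.
have til : Q (fun i j k l => 'd_(i, l) * f j k * B i j k l) = 0.
  by rewrite Q12 -[RHS]tjl; apply: eqQ => i j k l; rewrite -B12.
have tjk : Q (fun i j k l => 'd_(j, k) * f i l * B i j k l) = 0.
  by rewrite Q34 -[RHS]tjl; apply: eqQ => i j k l; rewrite -B34.
have tik : Q (fun i j k l => 'd_(i, k) * f j l * B i j k l) = 0.
  by rewrite Q12 -[RHS]tjk; apply: eqQ => i j k l; rewrite -B12.
have tij : Q (fun i j k l => 'd_(i, j) * f k l * B i j k l) = 0.
  by rewrite Q23 -[RHS]tik; apply: eqQ => i j k l; rewrite -B23.
have QD F G : Q F + Q G = Q (fun i j k l => F i j k l + G i j k l).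
  by rewrite /Q -big_split; do 3![apply: eq_bigr => ? _; rewrite -big_split].
transitivity (Q (fun i j k l => 'd_(i, j) * f k l * B i j k l)
  + Q (fun i j k l => 'd_(i, k) * f j l * B i j k l)
  + Q (fun i j k l => 'd_(i, l) * f j k * B i j k l)
  + Q (fun i j k l => 'd_(j, k) * f i l * B i j k l)
  + Q (fun i j k l => 'd_(j, l) * f i k * B i j k l)
  + Q (fun i j k l => 'd_(k, l) * f i j * B i j k l)); last first.
  by rewrite tij tik til tjk tjl tkl !addr0.
rewrite !QD.
by apply: eqQ => i j k l; ring.
Qed.

(** Apart from the product of four coordinates, the terms of [harm4 u] form a six-term sum
    orthogonal to [harm4 v]. It remains to contract [harm4 v] four times with [u]. *)
Lemma inner_harm4 u v : inner u u = 1 -> inner v v = 1 ->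
  \sum_i \sum_j \sum_k \sum_l harm4 u i j k l * harm4 v i j k l
  = inner u v ^+ 4 - 6 * (n + 4)^-1 * inner u v ^+ 2
    + 3 * ((n + 2) * (n + 4))^-1.
Proof.
move=> uu vv.
set c : R := (n + 4)^-1; set e : R := ((n + 2) * (n + 4))^-1; set t := inner u v.
(* The factor [2^-1]: each product of two deltas occurs twice in the six-term
   sum of [traceless_orthogonal]. *)
pose f i j : R := - c * u i * u j + 2^-1 * e * 'd_(i, j).
transitivity (\sum_i u i * \sum_j u j * \sum_k u k * \sum_l u l * harm4 v i j k l).
  rewrite -[RHS]addr0 -[X in _ + X](@traceless_orthogonal (harm4 v) f); first last.
  - by move=> i j; exact: harm4_trace.
  - by move=> i j k l; rewrite /harm4 (deltaC l k); ring.
  - by move=> i j k l; rewrite /harm4 (deltaC k j); ring.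
  - by move=> i j k l; rewrite /harm4 (deltaC j i); ring.
  rewrite -big_split /=; apply: eq_bigr => i _.
  rewrite mulr_sumr -big_split /=; apply: eq_bigr => j _.
  rewrite !mulr_sumr -big_split /=; apply: eq_bigr => k _.
  rewrite !mulr_sumr -big_split /=; apply: eq_bigr => l _.
  by rewrite [harm4 u _ _ _ _]/harm4 -/c -/e /f; field.
have c4 i j k : \sum_l u l * harm4 v i j k l
    = t * (v i * v j * v k
           - c * ('d_(i, j) * v k + 'd_(i, k) * v j + 'd_(j, k) * v i))
      + (e * 'd_(j, k) - c * v j * v k) * u i
      + (e * 'd_(i, k) - c * v i * v k) * u j
      + (e * 'd_(i, j) - c * v i * v j) * u k.
  transitivity ((v i * v j * v k
      - c * ('d_(i, j) * v k + 'd_(i, k) * v j + 'd_(j, k) * v i)) * t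
    + 0 * inner u u + (e * 'd_(j, k) - c * v j * v k) * u i
    + (e * 'd_(i, k) - c * v i * v k) * u j
    + (e * 'd_(i, j) - c * v i * v j) * u k); last by ring.
  by rewrite -contract; apply: eq_bigr => l _; rewrite /harm4 -/c -/e; ring.
have c3 i j : \sum_k u k * (\sum_l u l * harm4 v i j k l)
    = (t ^+ 2 - c) * v i * v j - 2 * c * t * (v j * u i + v i * u j)
      + (e - c * t ^+ 2) * 'd_(i, j) + 2 * e * u i * u j.
  transitivity ((t * (v i * v j - c * 'd_(i, j)) - c * v j * u i - c * v i * u j) * t
    + (e * 'd_(i, j) - c * v i * v j) * inner u u
    + (e * u j - t * c * v j) * u i + (e * u i - t * c * v i) * u j + 0 * u i);
    last by rewrite uu; ring.
  by rewrite -contract; apply: eq_bigr => k _; rewrite c4; ring.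
have c2 i : \sum_j u j * (\sum_k u k * (\sum_l u l * harm4 v i j k l))
    = (t ^+ 3 - 3 * c * t) * v i + 3 * (e - c * t ^+ 2) * u i.
  transitivity (((t ^+ 2 - c) * v i - 2 * c * t * u i) * t
    + (2 * e * u i - 2 * c * t * v i) * inner u u
    + (e - c * t ^+ 2) * u i + 0 * u i + 0 * u i); last by rewrite uu; ring.
  by rewrite -contract; apply: eq_bigr => j _; rewrite c3; ring.
under eq_bigr do rewrite c2.
by rewrite inner_comb uu -/t; ring.
Qed.

End HarmonicTensors.

(** * Positive definiteness of the Gegenbauer polynomials of degree at most 4 *)

Section GegenbauerPositive.
Variables (R : realType) (n : nat).
Hypothesis n2 : (2 <= n)%N.
Implicit Types (s : seq 'rV[R]_n).

Local Notation unit_seq s := (forall x, x \in s -> dotp x x = 1).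

Lemma inner_dotp (x y : 'rV[R]_n) : inner (x 0) (y 0) = dotp x y.
Proof. by []. Qed.

(** Exchanging the sums exhibits the squared length of the sum of all the vectors [F x]. *)
Lemma gram_ge0 (T : Type) (s : seq T) (J : finType) (F : T -> J -> R) :
  0 <= \sum_(x <- s) \sum_(y <- s) \sum_j F x j * F y j.
Proof.
rewrite (_ : \sum_(x <- s) _ = \sum_j (\sum_(x <- s) F x j) ^+ 2).
  by apply: sumr_ge0 => j _; exact: sqr_ge0.
under eq_bigr do rewrite exchange_big.
rewrite exchange_big; apply: eq_bigr => j _ /=.
by rewrite expr2 mulr_suml; apply: eq_bigr => x _; rewrite mulr_sumr.
Qed.

Lemma gram_pos s (J : finType) (F : 'rV[R]_n -> J -> R) (g : R -> R) (c : R) :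
  0 < c -> unit_seq s ->
  (forall x y, dotp x x = 1 -> dotp y y = 1 ->
    c * g (dotp x y) = \sum_j F x j * F y j) ->
  0 <= \sum_(x <- s) \sum_(y <- s) g (dotp x y).
Proof.
(* The kernel identity is known for unit vectors only, so [big_seq] keeps membership in [s]
   available under both sums. *)
move=> c0 s1 gE; rewrite -(pmulr_rge0 _ c0) mulr_sumr big_seq.
under eq_bigr => x xs.
  rewrite mulr_sumr big_seq; under eq_bigr => y ys do rewrite gE ?s1 //.
  rewrite -big_seq; over.
by rewrite -big_seq; exact: gram_ge0.
Qed.

(** The Gram vectors are the constant 1, the point itself, and its harmonic tensors of degree 2, 3,
    4. Their inner products are monic in [dotp x y], so the scaling constant is the inverse of the
    leading coefficient of the Gegenbauer polynomial, positive because [n] is at least 2. *)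
Lemma gegenbauer_posdef s k : (k <= 4)%N -> unit_seq s ->
  0 <= \sum_(x <- s) \sum_(y <- s) (gegenbauer R n k).[dotp x y].
Proof.
move=> k4 s1; have n2R : 2 <= n%:R :> R by rewrite ler_nat.
have I0 : (0 < #|'I_n|)%N by rewrite card_ord (leq_trans _ n2).
have nz (d : R) : 0 <= d -> n%:R + d != 0 by move=> d0; apply: lt0r_neq0; lra.
have n1 : n%:R - 1 != 0 :> R by apply: lt0r_neq0; lra.
have n0 : n%:R != 0 :> R by apply: lt0r_neq0; lra.
have GSS m t : (gegenbauer R n m.+2).[t] = (m.+2%:R + n%:R - 3)^-1 *
    ((2 * m.+2%:R + n%:R - 4) * (t * (gegenbauer R n m.+1).[t])
     - (m.+2%:R - 1) * (gegenbauer R n m).[t]).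
  by rewrite gegenbauerSS hornerZ hornerD hornerN !hornerZ hornerM hornerX.
have G2 t : (gegenbauer R n 2).[t] = (n%:R * t ^+ 2 - 1) / (n%:R - 1).
  rewrite GSS hornerX hornerC; field.
  by rewrite n1.
have G3 t : (gegenbauer R n 3).[t] = ((n%:R + 2) * t ^+ 3 - 3 * t) / (n%:R - 1).
  by rewrite GSS G2 hornerX; field; apply/andP; split; apply: lt0r_neq0; lra.
have G4 t : (gegenbauer R n 4).[t] =
    ((n%:R + 4) * (n%:R + 2) * t ^+ 4 - (6 * n%:R + 12) * t ^+ 2 + 3)
      / ((n%:R - 1) * (n%:R + 1)).
  by rewrite GSS G2 G3; field; apply/andP; split; apply: lt0r_neq0; lra.
case: k k4 => [|[|[|[|[|//]]]]] _.
- apply: (@gram_pos _ 'I_1 (fun _ _ => 1) (fun t => (gegenbauer R n 0).[t]) 1) => //.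
  by move=> x y _ _; rewrite big_ord1 hornerC.
- apply: (@gram_pos _ 'I_n (fun x => x 0) (fun t => (gegenbauer R n 1).[t]) 1) => //.
  by move=> x y _ _; rewrite hornerX mul1r.
- apply: (@gram_pos _ ('I_n * 'I_n)%type (fun x p => harm2 (x 0) p.1 p.2)
    (fun t => (gegenbauer R n 2).[t]) ((n%:R - 1) / n%:R)) => //.
    by apply: divr_gt0; lra.
  move=> x y xx yy; rewrite -(pair_bigA _ (fun i j => harm2 (x 0) i j * harm2 (y 0) i j)).
  rewrite /= inner_harm2 // inner_dotp card_ord G2; field.
  by rewrite n1 n0.
- apply: (@gram_pos _ ('I_n * ('I_n * 'I_n))%type
    (fun x p => harm3 (x 0) p.1 p.2.1 p.2.2)
    (fun t => (gegenbauer R n 3).[t]) ((n%:R - 1) / (n%:R + 2))) => //.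
    by apply: divr_gt0; lra.
  move=> x y xx yy.
  transitivity (\sum_i \sum_j \sum_k harm3 (x 0) i j k * harm3 (y 0) i j k).
    rewrite /= inner_harm3 // inner_dotp card_ord G3; field.
    by rewrite n1 nz.
  rewrite -(pair_bigA _ (fun i p => harm3 (x 0) i p.1 p.2 * harm3 (y 0) i p.1 p.2)).
  by apply: eq_bigr => i _; rewrite pair_bigA.
- apply: (@gram_pos _ (('I_n * 'I_n) * ('I_n * 'I_n))%type
    (fun x p => harm4 (x 0) p.1.1 p.1.2 p.2.1 p.2.2)
    (fun t => (gegenbauer R n 4).[t])
    ((n%:R - 1) * (n%:R + 1) / ((n%:R + 2) * (n%:R + 4)))) => //.
    by apply: divr_gt0; apply: mulr_gt0; lra.
  move=> x y xx yy.
  transitivity (\sum_i \sum_j \sum_k \sum_l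
      harm4 (x 0) i j k l * harm4 (y 0) i j k l).
    rewrite /= inner_harm4 // inner_dotp card_ord G4; field.
    by rewrite n1 !nz.
  rewrite pair_bigA; under eq_bigr do rewrite pair_bigA.
  by rewrite pair_bigA.
Qed.

(** * The linear programming bound *)

Lemma gegenbauer_lower_bound (p : {poly R}) s :
  (size p <= 5)%N -> (forall k, 0 <= gegenbauer_coef n p k) -> unit_seq s ->
  gegenbauer_coef n p 0 * (size s)%:R ^+ 2
    <= \sum_(x <- s) \sum_(y <- s) p.[dotp x y].
Proof.
move=> p5 p0 s1; set f := gegenbauer_coefs n p.
have pE : p = gegenbauer_sum n f by apply/gegenbauer_coefsP.
(* Gegenbauer expansion preserves degree, so only degrees 0 to 4 occur. *)
have f5 : (size f <= 5)%N by rewrite -(size_gegenbauer_sum f n2) -pE.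
have -> : \sum_(x <- s) \sum_(y <- s) p.[dotp x y] =
    \sum_(k < 5) f`_k * \sum_(x <- s) \sum_(y <- s) (gegenbauer R n k).[dotp x y].
  under [RHS]eq_bigr do rewrite mulr_sumr.
  rewrite [RHS]exchange_big; apply: eq_bigr => x _ /=.
  under [RHS]eq_bigr do rewrite mulr_sumr.
  rewrite [RHS]exchange_big; apply: eq_bigr => y _ /=.
  rewrite [in LHS]pE (gegenbauer_sumE _ f5) horner_sum.
  by apply: eq_bigr => k _; rewrite hornerZ.
have G0 : \sum_(x <- s) \sum_(y <- s) (gegenbauer R n 0).[dotp x y]
    = (size s)%:R ^+ 2.
  transitivity (\sum_(x <- s) \sum_(y <- s) (1 : R)).
    by do 2![apply: eq_bigr => ? _]; rewrite hornerC.
  have sum1 (c : R) : \sum_(x <- s) c = c * (size s)%:R.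
    by rewrite big_tnth sumr_const card_ord mulr_natr.
  by rewrite !sum1 mul1r.
(* The degree 0 term is the claimed bound; all others are nonnegative. *)
rewrite -G0 big_ord_recl lerDl.
apply: sumr_ge0 => k _; apply: mulr_ge0; first exact: p0.
by apply: gegenbauer_posdef => //; exact: ltn_ord (lift ord0 k).
Qed.

(** Membership in [D] controls only the coefficients below [size p]; this extends nonnegativity to
    every index. *)
Lemma gegenbauer_coef_default (p : {poly R}) k :
  (size p <= k)%N -> gegenbauer_coef n p k = 0.
Proof.
move=> pk; rewrite /gegenbauer_coef nth_default //.
rewrite -(size_gegenbauer_sum _ n2); apply: leq_trans pk.
by rewrite (_ : gegenbauer_sum n _ = p) //; apply/esym/gegenbauer_coefsP.
Qed.

(** In the double sum of [p.[dotp x y]] the off-diagonal terms vanish, since [a] and [b] are roots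
    of [p], and each diagonal term is [p.[1]]. *)
Lemma two_distance_bound (S : set 'rV[R]_n) (a b : R) (p : {poly R}) s :
  spherical_two_distance_set S a b -> p.[a] = 0 -> p.[b] = 0 ->
  (size p <= 5)%N -> (forall k, 0 <= gegenbauer_coef n p k) ->
  uniq s -> {in s, forall x, S x} ->
  gegenbauer_coef n p 0 * (size s)%:R ^+ 2 <= (size s)%:R * p.[1].
Proof.
move=> [_ _ S1 S2] pa pb p5 p0 us sS.
apply: le_trans (gegenbauer_lower_bound p5 p0 _) _ => [x /sS /S1 //|].
rewrite big_seq (_ : \sum_(_ <- s | _) _ = \sum_(x <- s) p.[1]).
  by rewrite big_tnth sumr_const card_ord mulr_natl.
rewrite [RHS]big_seq; apply: eq_bigr => x xs.
rewrite (bigD1_seq x) //= (S1 x (sS x xs)) big_seq_cond big1 ?addr0 // => y /andP[ys yx].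
have xy : x <> y by apply/eqP; rewrite eq_sym.
by case: (S2 x y (sS x xs) (sS y ys) xy) => ->.
Qed.

(** The lower bound applied to a single unit vector compares [p.[1]] with the constant
    coefficient. *)
Lemma expansion_at1_ge0 (p : {poly R}) : (size p <= 5)%N ->
  (forall k, 0 <= gegenbauer_coef n p k) -> 0 <= p.[1].
Proof.
move=> p5 p0; pose e : 'rV[R]_n := delta_mx 0 (Ordinal (ltnW n2)).
have e1 : dotp e e = 1.
  rewrite /dotp (bigD1 (Ordinal (ltnW n2))) //= big1 => [|i /negbTE ie].
    by rewrite mxE !eqxx mulr1 addr0.
  by rewrite mxE ie andbF mul0r.
have := @gegenbauer_lower_bound p [:: e] p5 p0.
rewrite !big_seq1 e1 /= expr1n mulr1 => H; apply: le_trans (p0 0%N) (H _).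
by move=> x; rewrite inE => /eqP ->.
Qed.

End GegenbauerPositive.

(** * Application to the five polynomials *)

Lemma P_factor (R : realType) (n i : nat) (a b : R) :
  exists2 q : {poly R}, P n i a b = quad a b * q & (size q <= 3)%N.
Proof.
have q0 : exists2 q : {poly R}, 0 = quad a b * q & (size q <= 3)%N.
  by exists 0; rewrite ?mulr0 ?size_poly0.
have q1 : exists2 q : {poly R}, quad a b = quad a b * q & (size q <= 3)%N.
  by exists 1; rewrite ?mulr1 ?size_poly1.
have q2 c : exists2 q : {poly R}, cubic a b c = quad a b * q & (size q <= 3)%N.
  by exists ('X + c%:P); rewrite ?size_XaddC.
have q4 cd : exists2 q : {poly R}, quartic a b cd = quad a b * q & (size q <= 3)%N.
  exists ('X^2 + cd.1 *: 'X + cd.2%:P) => //.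
  rewrite (leq_trans (size_polyD _ _)) // geq_max (leq_trans (size_polyC_leq1 _)) //.
  rewrite andbT (leq_trans (size_polyD _ _)) // geq_max size_polyXn /=.
  by rewrite (leq_trans (size_scale_leq _ _)) // size_polyX.
by case: i => [|[|[|[|[|[|i]]]]]];
  [exact: q0 | exact: q1 | exact: q2 | exact: q2 | exact: q4 | exact: q4 | exact: q0].
Qed.

Theorem theorem4 (R : realType) (n : nat) (S : set 'rV[R]_n) (a b : R)
    (i : nat) :
  (2 <= n)%N ->
  spherical_two_distance_set S a b ->
  (1 <= i <= 5)%N ->
  D n i (a, b) ->
  finite_set S /\ (#|` fset_set S|)%:R <= U n i a b.
Proof.
move=> n2 tdS _ [_ _ _ fP f0]; rewrite /U.
(* After this generalization [p] is known only through its factor [quad a b], its degree bound and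
   the signs of its coefficients. *)
have [q PE q3] := P_factor n i a b; move: (P n i a b) PE fP f0 => p pE fp f0.
have pa : p.[a] = 0 by rewrite pE /quad !hornerE subrr !mul0r.
have pb : p.[b] = 0 by rewrite pE /quad !hornerE subrr mulr0 mul0r.
have p5 : (size p <= 5)%N.
  rewrite pE (leq_trans (size_polyMleq _ _)) // /quad.
  rewrite size_Mmonic ?monicXsubC ?polyXsubC_eq0 // !size_XsubC.
  exact: q3.
have p0 k : 0 <= gegenbauer_coef n p k.
  by have [/fp //|pk] := ltnP k (size p); rewrite gegenbauer_coef_default.
have U0 : 0 <= p.[1] / gegenbauer_coef n p 0.
  by rewrite divr_ge0 ?(expansion_at1_ge0 n2).
(* Stated for finite lists of distinct points of [S], so that it yields both finiteness and the
   cardinality bound. The empty list, where one cannot cancel [size s], is covered by [U0]. *)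
have bound s : uniq s -> {in s, forall x, S x} ->
    (size s)%:R <= p.[1] / gegenbauer_coef n p 0.
  move=> us sS; have [->|s0] := posnP (size s); first exact: U0.
  have := two_distance_bound n2 tdS pa pb p5 p0 us sS.
  rewrite expr2 mulrCA ler_pM2l ?ltr0n // => H.
  by rewrite ler_pdivlMr // mulrC.
have finS : finite_set S.
  apply: contrapT => infS.
  (* An infinite [S] would contain a finite subset with at least [Num.bound] of the claimed bound
     many points, which strictly exceeds that bound. *)
  have [B BS] := infinite_set_fset (Num.bound (p.[1] / gegenbauer_coef n p 0)) infS.
  have := bound B (fset_uniq B) (fun x xB => BS x xB).
  rewrite leNgt => /negP H; rewrite -(ler_nat R) => BN; apply: H.
  by apply: lt_le_trans BN; exact: archi_boundP.
split=> //; apply: bound; first exact: fset_uniq.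
by move=> x; rewrite in_fset_set // inE.
Qed.
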